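(* Let $N\ge 2$, $p\in(0,1)$, and let $\mathbf f=(f_1,\dots,f_N)$, $\mathbf g=(g_1,\dots,g_N)$, $\mathbf x=(x_1,\dots,x_N)$ be fixed real vectors with $\mathbf x$ not constant. Let $T_1,\dots,T_N$ be i.i.d. Bernoulli$(p)$ random variables and $Y_i=f_i+g_iT_i$. Let $\hat{\bar g}_{SLR}$ and $\hat{\bar g}_{MLR}$ be the simple and multiple linear regression estimators of $\bar g=\frac1N\sum_i g_i$, and let $\mathrm{Var}(\hat{\bar g}_{SLR}-\bar g)$ and $\mathrm{Var}(\hat{\bar g}_{MLR}-\bar g)$ denote their (Taylor-approximated) variances, all as defined in the context. Say that one estimator performs at least as well as the other if its variance in this sense is less than or equal to that of the other. Then: 1. If $\mathrm{Cov}(\mathbf g,\mathbf x)=0$ or $p=\tfrac12$, then MLR performs at least as well as SLR: $\mathrm{Var}(\hat{\bar g}_{MLR}-\bar g)\le \mathrm{Var}(\hat{\bar g}_{SLR}-\bar g)$. 2. Otherwise, i.e. if $\mathrm{Cov}(\mathbf g,\mathbf x)\neq 0$ and $p\ne\frac12$, which of the two estimators has the smaller variance (the sign of $\mathrm{Var}(\hat{\bar g}_{SLR}-\bar g)-\mathrm{Var}(\hat{\bar g}_{MLR}-\bar g)$) is determined by the pair $(p,k)$ with $k=\mathrm{Cov}(\mathbf f,\mathbf x)/\mathrm{Cov}(\mathbf g,\mathbf x)$, and is not the same for all such pairs. 3. If $\mathbf x$ has unit empirical variance, i.e. $\frac1N\sum_i (x_i-\bar x)^2=1$, then $$\mathrm{Var}(\hat{\bar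 g}_{SLR}-\bar g)-\mathrm{Var}(\hat{\bar g}_{MLR}-\bar g)=\frac{\Delta}{p(1-p)N},$$ where $$\Delta=(\mathrm{Cov}(\mathbf f,\mathbf x))^2+2(1-p)\,\mathrm{Cov}(\mathbf g,\mathbf x)\,\mathrm{Cov}(\mathbf f,\mathbf x)+(2p-3p^2)(\mathrm{Cov}(\mathbf g,\mathbf x))^2 .$$
   Context: Model: $Y_i=f_i+g_iT_i$ is the observed consumption of sample $i$; $f_i$ is the main (baseline) effect, $g_i$ the treatment effect, $x_i$ a scalar covariate, all deterministic; $T_i$ is the binary treatment indicator and the only source of randomness. The average treatment effect is $\bar g=\frac1N\sum_i g_i$; similarly $\bar f=\frac1N\sum_i f_i$ and $\bar x=\frac1N\sum_i x_i$. Empirical covariance of vectors: $\mathrm{Cov}(\mathbf f,\mathbf x)=\frac1N\sum_i (f_i-\bar f)(x_i-\bar x)$ and $\mathrm{Cov}(\mathbf g,\mathbf x)=\frac1N\sum_i (g_i-\bar g)(x_i-\bar x)$. Estimators: $\hat{\bar g}_{SLR}$ is the ordinary least squares coefficient of $T_i-p$ when $Y_i$ is regressed on $(T_i-p,\,1)$; equivalently $$\hat{\bar g}_{SLR}=\frac{\sum_i T_i(g_i+f_i)}{\sum_i T_i}-\frac{\sum_i(1-T_i)f_i}{\sum_i(1-T_i)}.$$ $\hat{\bar g}_{MLR}$ is the ordinary least squares coefficient of $T_i-p$ when $Y_i$ is regressed on $(T_i-p,\,x_i,\,1)$. Approximation convention for variances: higher order terms are ignored and variances of estimators are replaced by their Taylor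 (delta-method) approximations. That is, the estimation error is a rational function $h(S)$ of a vector $S$ of sample averages $S=\frac1N\sum_i s_i$ with $s_i$ independent random vectors (the entries of $s_i$ being $T_i$, $T_ix_i$, $T_if_i$, $T_ig_i$, $T_ig_ix_i$), and $\mathrm{Var}(h(S))$ means $\nabla h(\mathbb E S)^{\top}\,\mathrm{Cov}(S)\,\nabla h(\mathbb E S)$, where here $\mathrm{Cov}(S)$ is the covariance matrix of the random vector $S$. For a ratio $X/Y$ of random variables this is $\mathrm{Var}(X/Y)\approx \frac{\mathrm{Var}X}{(\mathbb EY)^2}-\frac{2\,\mathbb EX}{(\mathbb EY)^3}\mathrm{Cov}(X,Y)+\frac{(\mathbb EX)^2}{(\mathbb EY)^4}\mathrm{Var}Y$, which equals $\mathrm{Var}X/(\mathbb EY)^2$ when $\mathbb EX=0$. *)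

(* Defs.v *)
From HB Require Import structures.
From mathcomp Require Import all_boot all_order all_algebra.
From mathcomp Require Import ring lra.
From mathcomp Require Import all_classical all_reals all_analysis.

Set Implicit Arguments.
Unset Strict Implicit.
Unset Printing Implicit Defensive.

Import Order.TTheory GRing.Theory Num.Theory.
Import numFieldNormedType.Exports.

Local Open Scope classical_set_scope.
Local Open Scope ring_scope.

Definition mean (R : realType) (N : nat) (a : 'I_N -> R) : R :=
  N%:R^-1 * \sum_i a i.

Definition ecov (R : realType) (N : nat) (a b : 'I_N -> R) : R :=
  mean (fun i => (a i - mean a) * (b i - mean b)).

Definition mutually_independent d d' (Om : measurableType d)
    (E : measurableType d') (R : realType) (P : probability Om R)
    (N : nat) (X : 'I_N -> Om -> E) : Prop :=
  forall (J : {set 'I_N}) (A : 'I_N -> set E),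
    (forall i, measurable (A i)) ->
    P (\bigcap_(i in [set` J]) (X i @^-1` A i)) =
    (\big[mule/1]_(i in J) P (X i @^-1` A i))%E.

Definition iid_bernoulli d (Om : measurableType d) (R : realType)
    (P : probability Om R) (p : R) (N : nat) (T : 'I_N -> {RV P >-> bool}) :
    Prop :=
  (forall i A, distribution P (T i) A = bernoulli_prob p A) /\
  mutually_independent P (fun i => T i : Om -> bool).

Definition randomized_experiment d (Om : measurableType d) (R : realType)
    (P : probability Om R) (p : R) (N : nat) (T : 'I_N -> {RV P >-> bool})
    (x : 'I_N -> R) : Prop :=
  [/\ (2 <= N)%N, 0 < p < 1, (exists i j, x i != x j) & iid_bernoulli p T].

Definition is_ols (R : realType) (n m : nat) (Z : 'M[R]_(n, m)) (y : 'cV[R]_n)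
    (b : 'cV[R]_m) : Prop :=
  forall b' : 'cV[R]_m,
    \sum_i ((y - Z *m b) i 0) ^+ 2 <= \sum_i ((y - Z *m b') i 0) ^+ 2.

Definition mx_of_rows (R : realType) (m n : nat) (rows : seq (seq R)) :
    'M[R]_(m, n) :=
  \matrix_(i, j) nth 0 (nth [::] rows i) j.

Section estimators.
Context (R : realType) (N : nat) (p : R) (f g x : 'I_N -> R).

Definition response (t : 'I_N -> R) : 'cV[R]_N :=
  \col_i (f i + g i * t i).

Definition slr_design (t : 'I_N -> R) : 'M[R]_(N, 2) :=
  \matrix_(i, j) [:: t i - p; 1]`_j.

Definition mlr_design (t : 'I_N -> R) : 'M[R]_(N, 3) :=
  \matrix_(i, j) [:: t i - p; x i; 1]`_j.

(* The vector S of sample averages of T, T x, T f, T g and T g x. *)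
Definition stats (t : 'I_N -> R) : 'rV[R]_5 :=
  \row_j mean (fun i => t i * [:: 1; x i; f i; g i; g i * x i]`_j).

Section moments.
Context (s : 'rV[R]_5).
Let mT := s 0 0.
Let mTx := s 0 1.
Let mTf := s 0 2.
Let mTg := s 0 3.
Let mTgx := s 0 4.

(* Normal equations of the two regressions divided by N, expressed through S  *)
(* using T ^ 2 = T. slr_error and mlr_error are the estimation errors as       *)
(* rational functions of S: by slr_errorE and mlr_errorE below, they coincide  *)
(* with the least squares coefficient of T - p minus the mean of g whenever    *)
(* the regressors are linearly independent.                                    *)
Definition slr_gram : 'M[R]_2 := mx_of_rows 2 2
  [:: [:: (1 - 2 * p) * mT + p ^+ 2; mT - p];
      [:: mT - p;                    1     ]].

Definition slr_rhs : 'cV[R]_2 := mx_of_rows 2 1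
  [:: [:: mTf + (1 - p) * mTg - p * mean f];
      [:: mean f + mTg]].

Definition mlr_gram : 'M[R]_3 := mx_of_rows 3 3
  [:: [:: (1 - 2 * p) * mT + p ^+ 2; mTx - p * mean x;        mT - p];
      [:: mTx - p * mean x;          mean (fun i => x i ^+ 2); mean x];
      [:: mT - p;                    mean x;                  1     ]].

Definition mlr_rhs : 'cV[R]_3 := mx_of_rows 3 1
  [:: [:: mTf + (1 - p) * mTg - p * mean f];
      [:: mean (fun i => x i * f i) + mTgx];
      [:: mean f + mTg]].

Definition slr_error : R := (invmx slr_gram *m slr_rhs) 0 0 - mean g.

Definition mlr_error : R := (invmx mlr_gram *m mlr_rhs) 0 0 - mean g.
End moments.

End estimators.

Definition gradient (R : realType) (n : nat) (h : 'rV[R]_n.+1 -> R)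
    (a : 'rV[R]_n.+1) : 'rV[R]_n.+1 :=
  \row_j 'D_(delta_mx 0 j) (h : 'rV[R]_n.+1 -> R^o) a.

Section delta_method.
Context d (Om : measurableType d) (R : realType) (P : probability Om R).

Definition mean_vector (n : nat) (S : Om -> 'rV[R]_n) : 'rV[R]_n :=
  \row_j fine 'E_P[fun w => S w 0 j].

Definition cov_matrix (n : nat) (S : Om -> 'rV[R]_n) : 'M[R]_n :=
  \matrix_(i, j) fine (covariance P (fun w => S w 0 i) (fun w => S w 0 j)).

Definition taylor_variance (n : nat) (S : Om -> 'rV[R]_n.+1)
    (h : 'rV[R]_n.+1 -> R) : R :=
  let dh := gradient h (mean_vector S) in
  (dh *m cov_matrix S *m dh^T) 0 0.

Context (p : R) (N : nat) (T : 'I_N -> {RV P >-> bool}) (f g x : 'I_N -> R).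

Definition sample_stats (w : Om) : 'rV[R]_5 :=
  stats f g x (fun i => (T i w)%:R).

Definition var_slr : R := taylor_variance sample_stats (slr_error p f g).

Definition var_mlr : R := taylor_variance sample_stats (mlr_error p f g x).
End delta_method.

Section ols_error.
Context (R : realType).

Lemma is_ols_normal n m (Z : 'M[R]_(n, m)) (y : 'cV[R]_n) (b : 'cV[R]_m) :
  is_ols Z y b -> Z^T *m Z *m b = Z^T *m y.
Proof.
move=> bmin; set r := y - Z *m b; pose v := Z^T *m r.
suff v0 : v = 0.
  apply/esym/eqP; rewrite -subr_eq0 -mulmxA -mulmxBr; exact/eqP.
pose A := \sum_i (v i 0) ^+ 2; pose B := \sum_i ((Z *m v) i 0) ^+ 2.
have A0 : 0 <= A by apply: sumr_ge0 => i _; exact: sqr_ge0.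
have B0 : 0 <= B by apply: sumr_ge0 => i _; exact: sqr_ge0.
have rv : \sum_i r i 0 * (Z *m v) i 0 = A.
  have -> : \sum_i r i 0 * (Z *m v) i 0 = ((Z *m v)^T *m r) 0 0.
    by rewrite mxE; apply: eq_bigr => i _; rewrite [_^T _ _]mxE mulrC.
  rewrite trmx_mul -mulmxA mxE; apply: eq_bigr => i _.
  by rewrite [v^T _ _]mxE expr2.
have key e : 2 * e * A <= e ^+ 2 * B.
  have := bmin (b + e *: v).
  have -> : \sum_i ((y - Z *m (b + e *: v)) i 0) ^+ 2 =
      \sum_i (r i 0) ^+ 2 - 2 * e * A + e ^+ 2 * B.
    rewrite -rv /B !mulr_sumr -sumrB -big_split; apply: eq_bigr => i _ /=.
    rewrite mulmxDr -scalemxAr opprD addrA -/r.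
    by move: (Z *m v) => u; rewrite !mxE; ring.
  by rewrite -/r; lra.
have A00 : A = 0.
  have B1 : 0 < 1 + B by lra.
  have := key (A / (1 + B)); rewrite -(ler_pM2l (exprn_gt0 2 B1)).
  have -> : (1 + B) ^+ 2 * (2 * (A / (1 + B)) * A) = 2 * (1 + B) * A ^+ 2.
    by field; rewrite gt_eqF.
  have -> : (1 + B) ^+ 2 * ((A / (1 + B)) ^+ 2 * B) = A ^+ 2 * B.
    by field; rewrite gt_eqF.
  move=> AB; apply/eqP; rewrite -sqrf_eq0 eq_le sqr_ge0 andbT; nra.
apply/matrixP => i j; rewrite (ord1 j) [RHS]mxE; apply/eqP.
rewrite -sqrf_eq0.
have /eqP := A00; rewrite psumr_eq0; last by move=> k _; exact: sqr_ge0.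
by move=> /allP /(_ i (mem_index_enum _)).
Qed.

Section sample.
Context (N : nat) (p : R) (f g x t : 'I_N -> R).
Context (N_gt0 : (0 < N)%N) (t01 : forall i, t i = 0 \/ t i = 1).

Let sum_lin (c1 c2 c3 c4 : R) (a1 a2 a3 F : 'I_N -> R) :
  (forall i, F i = c1 * a1 i + c2 * a2 i + c3 * a3 i + c4) ->
  \sum_i F i = N%:R * (c1 * mean a1 + c2 * mean a2 + c3 * mean a3 + c4).
Proof.
move=> FE; rewrite (eq_bigr _ (fun i _ => FE i)) !big_split /= -!mulr_sumr.
rewrite sumr_const card_ord -mulr_natl /mean.
by field; rewrite pnatr_eq0 -lt0n.
Qed.

Let S := stats f g x t.

Local Ltac lincomb c1 a1 c2 a2 c3 a3 c4 :=
  rewrite (@sum_lin c1 c2 c3 c4 a1 a2 a3);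
  [ by congr (_ * _); rewrite ?mxE /=; ring
  | let k := fresh "k" in let tk := fresh "tk" in
    intro k; rewrite !mxE /=; destruct (t01 k) as [tk | tk]; rewrite ?tk; ring ].

Local Ltac entries :=
  apply/matrixP; case=> -[|[|[|//]]] // ?; case=> -[|[|[|//]]] // ?;
  rewrite !mxE /=.

Lemma slr_gramE :
  (slr_design p t)^T *m slr_design p t = N%:R *: slr_gram p S.
Proof.
entries.
- by lincomb (1 - 2 * p) (fun i => t i * 1) (0 : R) (fun _ : 'I_N => 0 : R) (0 : R) (fun _ : 'I_N => 0 : R) (p ^+ 2).
- by lincomb (1 : R) (fun i => t i * 1) (0 : R) (fun _ : 'I_N => 0 : R) (0 : R) (fun _ : 'I_N => 0 : R) (- p).
- by lincomb (1 : R) (fun i => t i * 1) (0 : R) (fun _ : 'I_N => 0 : R) (0 : R) (fun _ : 'I_N => 0 : R) (- p).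
- by lincomb (0 : R) (fun _ : 'I_N => 0 : R) (0 : R) (fun _ : 'I_N => 0 : R) (0 : R) (fun _ : 'I_N => 0 : R) (1 : R).
Qed.

Lemma slr_rhsE :
  (slr_design p t)^T *m response f g t = N%:R *: slr_rhs p f S.
Proof.
entries.
- by lincomb (1 : R) (fun i => t i * f i) (1 - p) (fun i => t i * g i) (- p) (f) (0 : R).
- by lincomb (1 : R) (f) (1 : R) (fun i => t i * g i) (0 : R) (fun _ : 'I_N => 0 : R) (0 : R).
Qed.

Lemma mlr_gramE :
  (mlr_design p x t)^T *m mlr_design p x t = N%:R *: mlr_gram p x S.
Proof.
entries.
- by lincomb (1 - 2 * p) (fun i => t i * 1) (0 : R) (fun _ : 'I_N => 0 : R) (0 : R) (fun _ : 'I_N => 0 : R) (p ^+ 2).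
- by lincomb (1 : R) (fun i => t i * x i) (- p) (x) (0 : R) (fun _ : 'I_N => 0 : R) (0 : R).
- by lincomb (1 : R) (fun i => t i * 1) (0 : R) (fun _ : 'I_N => 0 : R) (0 : R) (fun _ : 'I_N => 0 : R) (- p).
- by lincomb (1 : R) (fun i => t i * x i) (- p) (x) (0 : R) (fun _ : 'I_N => 0 : R) (0 : R).
- by lincomb (1 : R) (fun i => x i ^+ 2) (0 : R) (fun _ : 'I_N => 0 : R) (0 : R) (fun _ : 'I_N => 0 : R) (0 : R).
- by lincomb (1 : R) (x) (0 : R) (fun _ : 'I_N => 0 : R) (0 : R) (fun _ : 'I_N => 0 : R) (0 : R).
- by lincomb (1 : R) (fun i => t i * 1) (0 : R) (fun _ : 'I_N => 0 : R) (0 : R) (fun _ : 'I_N => 0 : R) (- p).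
- by lincomb (1 : R) (x) (0 : R) (fun _ : 'I_N => 0 : R) (0 : R) (fun _ : 'I_N => 0 : R) (0 : R).
- by lincomb (0 : R) (fun _ : 'I_N => 0 : R) (0 : R) (fun _ : 'I_N => 0 : R) (0 : R) (fun _ : 'I_N => 0 : R) (1 : R).
Qed.

Lemma mlr_rhsE :
  (mlr_design p x t)^T *m response f g t = N%:R *: mlr_rhs p f x S.
Proof.
entries.
- by lincomb (1 : R) (fun i => t i * f i) (1 - p) (fun i => t i * g i) (- p) (f) (0 : R).
- by lincomb (1 : R) (fun i => x i * f i) (1 : R) (fun i => t i * (g i * x i)) (0 : R) (fun _ : 'I_N => 0 : R) (0 : R).
- by lincomb (1 : R) (f) (1 : R) (fun i => t i * g i) (0 : R) (fun _ : 'I_N => 0 : R) (0 : R).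
Qed.

Let solve m (Z : 'M[R]_(N, m)) (y : 'cV[R]_N) (G : 'M[R]_m) (r b : 'cV[R]_m) :
  Z^T *m Z = N%:R *: G -> Z^T *m y = N%:R *: r -> G \in unitmx ->
  is_ols Z y b -> b = invmx G *m r.
Proof.
move=> ZG Zr uG /is_ols_normal; rewrite ZG Zr -scalemxAl => /scalerI Gb.
by rewrite -Gb ?mulKmx// pnatr_eq0 -lt0n.
Qed.

(* The design matrices list T - p first, so its coefficient is b 0 0. *)
Lemma slr_errorE (b : 'cV[R]_2) :
  slr_gram p S \in unitmx -> is_ols (slr_design p t) (response f g t) b ->
  b 0 0 - mean g = slr_error p f g S.
Proof. by move=> u /(solve slr_gramE slr_rhsE u) ->. Qed.

Lemma mlr_errorE (b : 'cV[R]_3) :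
  mlr_gram p x S \in unitmx -> is_ols (mlr_design p x t) (response f g t) b ->
  b 0 0 - mean g = mlr_error p f g x S.
Proof. by move=> u /(solve mlr_gramE mlr_rhsE u) ->. Qed.

End sample.

End ols_error.

(* Main.v *)
Require Import Defs.
From HB Require Import structures.
From mathcomp Require Import all_boot all_order all_algebra.
From mathcomp Require Import ring lra.
From mathcomp Require Import all_classical all_reals all_analysis.
Import Order.TTheory GRing.Theory Num.Theory.
Import numFieldNormedType.Exports.
Local Open Scope classical_set_scope.
Local Open Scope ring_scope.

Set Implicit Arguments.
Unset Strict Implicit.
Unset Printing Implicit Defensive.

(** Both variances turn out to be empirical second moments of residuals of one
vector. Write u_i = (f_i - mean f) + (1 - p) (g_i - mean g) for the centred
values of (1 - p) Y_i(1) + p Y_i(0), where Y_i(1) = f_i + g_i and Y_i(0) = f_i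
are the two potential responses.

The regression coefficients solve a linear system G(S) b = r(S) whose entries
are affine in the sample averages S. Differentiating gives
db = G^-1 (dr - dG b) (derive_invmx), and at the expectation of S the regressor
T - p is orthogonal to the other regressors, so that the first row of G is
(p (1 - p), 0, ...) and the first entry of db is that of dr - dG b divided by
p (1 - p) (slr_gradient, mlr_gradient). Applied to the contribution s_i of unit
i to S, the gradient returns u_i / (p (1 - p)) for the simple regression and
(u_i - beta (x_i - mean x)) / (p (1 - p)) for the multiple one; here
beta = Cov(f + p g, x) / Cov(x, x), the slope of the expected response f + p g
on x. Independence of the T_i makes Cov(S) equal to
p (1 - p) / N^2 * sum_i s_i^T s_i (cov_matrix_sample), hence, with
q = p (1 - p),

  Var_SLR = mean(u^2) / (q N),
  Var_MLR = mean((u - beta (x - mean x))^2) / (q N).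

The slope beta is fitted to f + p g whereas u is made of f + (1 - p) g; this
mismatch is why adjusting for x may hurt. Expanding the square,

  Var_SLR - Var_MLR = beta (2 Cov(u, x) - beta Cov(x, x)) / (q N)
    = (Cov(f, x) + p Cov(g, x)) (Cov(f, x) + (2 - 3 p) Cov(g, x))
      / (q N Cov(x, x))                                    (var_slr_sub_mlr).

This is the third claim when Cov(x, x) = 1. The two factors coincide if
Cov(g, x) = 0 or p = 1/2, which is the first claim. Otherwise the sign is that
of (k + p) (k + 2 - 3 p). For p = 1/4 this is positive at k = 0 and negative at
k = -1/2, strictly between the roots -5/4 and -1/4; both values of k are
realized with f = k g and g = x. *)

(** * Derivatives of solutions of linear systems *)

(** Along a line, the determinant and the adjugate of a matrix are polynomials
in the parameter, so that the solution of a linear system is a quotient of two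
polynomials, continuous wherever the determinant does not vanish. *)
Lemma invmx_affine_cvg (R : realType) (n : nat) (A B : 'M[R]_n) (e : 'cV[R]_n)
    (i : 'I_n) : A \in unitmx ->
  (\forall h \near (0 : R)^', A + h *: B \in unitmx) /\
  (invmx (A + h *: B) *m e) i 0 @[h --> (0 : R)^'] --> (invmx A *m e) i 0.
Proof.
move=> uA.
pose M : 'M[{poly R}]_n := map_mx polyC A + 'X *: map_mx polyC B.
have ME h : map_mx (horner_eval h) M = A + h *: B.
  by apply/matrixP => k l; rewrite !mxE /= /horner_eval !hornerE.
pose D := \det M; pose q := ((\adj M) *m map_mx polyC e) i 0.
have DE h : \det (A + h *: B) = D.[h] by rewrite -ME det_map_mx.
have qE h : (\adj (A + h *: B) *m e) i 0 = q.[h].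
  rewrite -ME -map_mx_adj /q -/(horner_eval h _) !mxE rmorph_sum.
  by apply: eq_bigr => k _; rewrite rmorphM /= !mxE /= /horner_eval hornerC.
have A0 : A = A + 0 *: B by rewrite scale0r addr0.
have cont (r : {poly R}) : r.[h] @[h --> (0 : R)^'] --> r.[0].
  by apply: cvg_within_filter; exact: continuous_horner.
have D0 : D.[0] != 0 by rewrite -DE -A0 -unitfE -unitmxE.
have Dn0 : \forall h \near (0 : R)^', D.[h] != 0.
  exact: (cvgr_neq0 _ (cont D) D0).
have uE h : (A + h *: B \in unitmx) = (D.[h] != 0) by rewrite unitmxE unitfE DE.
have invE h : D.[h] != 0 ->
    (invmx (A + h *: B) *m e) i 0 = D.[h]^-1 * q.[h].
  by move=> Dh; rewrite /invmx uE Dh -scalemxAl mxE qE DE.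
split; first by near=> h; rewrite uE; near: h.
have -> : (invmx A *m e) i 0 = D.[0]^-1 * q.[0] by rewrite {1}A0 invE.
apply: cvg_trans (cvgM (cvgV D0 (cont D)) (cont q)).
apply: near_eq_cvg; near=> h; rewrite invE//; near: h; exact: Dn0.
Unshelve. all: by end_near. Qed.

(** As G and r are affine in the direction v, the solution b_h at h v + a satisfies
G (h v + a) (b_h - b) = h (dr - dG b) exactly: the difference quotient is itself
the solution of a linear system, of which only the continuity is needed. *)
Lemma derive_invmx (R : realType) (V : normedModType R) (n : nat)
    (G : V -> 'M[R]_n) (r : V -> 'cV[R]_n) (a v : V)
    (dG : 'M[R]_n) (dr b : 'cV[R]_n) (c : R) (i : 'I_n) :
    G a \in unitmx ->
    (forall h, G (h *: v + a) = G a + h *: dG) ->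
    (forall h, r (h *: v + a) = r a + h *: dr) ->
    G a *m b = r a ->
  'D_v ((fun s => (invmx (G s) *m r s) i 0 - c) : V -> R^o) a =
  (invmx (G a) *m (dr - dG *m b)) i 0.
Proof.
move=> uG GE rE Gb; have [uGh Gcvg] := invmx_affine_cvg dG (dr - dG *m b) i uG.
apply/cvg_lim => //; apply: cvg_trans Gcvg; apply: near_eq_cvg; near=> h.
have h0 : h != 0 by near: h; exact: nbhs_dnbhs_neq.
have uh : G a + h *: dG \in unitmx by near: h; exact: uGh.
rewrite /= GE rE -Gb mulKmx// opprB addrA subrK.
have -> : invmx (G a + h *: dG) *m (G a *m b + h *: dr) =
    b + h *: (invmx (G a + h *: dG) *m (dr - dG *m b)).
  rewrite -{2}(mulKmx uh b) scalemxAr -mulmxDr; congr (_ *m _).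
  by rewrite mulmxDl scalerBr -scalemxAl [_ - _]addrC addrA addrK.
rewrite [(b + _) i 0]mxE addrAC subrr add0r [X in h^-1 *: X]mxE.
by rewrite /GRing.scale /= mulrA mulVf// mul1r.
Unshelve. all: by end_near. Qed.

(** An unknown that is alone in its own equation can be read off without
inverting the rest of the system. *)
Lemma invmx_mul_row (R : fieldType) (n : nat) (G : 'M[R]_n) (e : 'cV[R]_n)
    (q : R) (i : 'I_n) : G \in unitmx -> row i G = q *: delta_mx 0 i ->
  q * (invmx G *m e) i 0 = e i 0.
Proof.
move=> uG Gi; rewrite -{2}(mulKVmx uG e).
have -> (y : 'cV[R]_n) : (G *m y) i 0 = (row i G *m y) 0 0.
  by rewrite -row_mul [RHS]mxE.
by rewrite Gi -scalemxAl -rowE !mxE.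
Qed.

Lemma det_mx22 (R : comPzRingType) (M : 'M[R]_2) :
  \det M = M 0 0 * M 1 1 - M 0 1 * M 1 0.
Proof.
rewrite (expand_det_row _ 0) !big_ord_recl big_ord0 /cofactor !det_mx11 !mxE.
have l0 : lift ord0 ord0 = 1 :> 'I_2 by exact: val_inj.
have l1 : lift (1 : 'I_2) ord0 = 0 by exact: val_inj.
by rewrite !l0 !l1 /= expr0 expr1 mul1r mulN1r mulrN addr0.
Qed.

(** * Empirical means and covariances *)

Section empirical_moments.
Context (R : realType) (N : nat).
Implicit Types (a b c : 'I_N -> R).

Lemma meanD a b : mean (fun i => a i + b i) = mean a + mean b.
Proof. by rewrite /mean big_split mulrDr. Qed.

Lemma meanZ (k : R) a : mean (fun i => k * a i) = k * mean a.
Proof. by rewrite /mean -mulr_sumr mulrCA. Qed.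

Lemma mean_cst (k : R) : (0 < N)%N -> mean (fun _ : 'I_N => k) = k.
Proof.
move=> N0; rewrite /mean sumr_const card_ord -[k *+ N]mulr_natl mulKf//.
by rewrite pnatr_eq0 -lt0n.
Qed.

Lemma ecovE a b : (0 < N)%N ->
  ecov a b = mean (fun i => a i * b i) - mean a * mean b.
Proof.
move=> N0; rewrite /ecov.
have -> : (fun i => (a i - mean a) * (b i - mean b)) =
    (fun i => a i * b i +
      (- mean a * b i + (- mean b * a i + mean a * mean b))).
  by apply/funext => i; ring.
by rewrite !meanD (mean_cst _ N0) !meanZ; ring.
Qed.

Lemma ecovC a b : ecov a b = ecov b a.
Proof. by congr mean; apply/funext => i; rewrite mulrC. Qed.

Lemma ecovZl (k : R) a b : ecov (fun i => k * a i) b = k * ecov a b.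
Proof.
rewrite /ecov -meanZ; congr mean; apply/funext => i.
by rewrite (meanZ _ a) -mulrBr mulrA.
Qed.

Lemma ecov_gt0 a i j : a i != a j -> 0 < ecov a a.
Proof.
move=> aij; have N0 : (0 < N)%N by case: N i {aij j} => // -[].
rewrite /ecov /mean mulr_gt0 ?invr_gt0 ?ltr0n//.
have sq_ge0 k : true -> 0 <= (a k - mean a) * (a k - mean a).
  by rewrite -expr2 sqr_ge0.
rewrite lt_neqAle sumr_ge0// andbT eq_sym psumr_eq0//.
apply: contra aij => /allP dev0.
have aE k : a k = mean a.
  have /dev0 /= := mem_index_enum k.
  by rewrite -expr2 sqrf_eq0 subr_eq0 => /eqP.
by rewrite !aE.
Qed.

End empirical_moments.

(** * Gradients of the estimation errors *)

Section gradients.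
Context (R : realType) (N : nat) (p : R) (f g x : 'I_N -> R).
Context (N0 : (0 < N)%N) (p01 : 0 < p < 1) (Vx : ecov x x != 0).

(** The contribution of unit i to the vector of sample averages when treated. *)
Definition loading (i : 'I_N) : 'rV[R]_5 :=
  \row_j [:: 1; x i; f i; g i; g i * x i]`_j.

Definition expected_stats : 'rV[R]_5 :=
  \row_j (p * mean (fun i => loading i 0 j)).

(** The centred value of (1 - p) Y_i(1) + p Y_i(0), with potential responses
Y_i(1) = f_i + g_i and Y_i(0) = f_i. *)
Definition outcome_dev i : R := (f i - mean f) + (1 - p) * (g i - mean g).

(** The least squares slope of the expected response f + p g on x: the
coefficient of x in the multiple regression at the expectation of S. *)
Definition slope : R := (ecov f x + p * ecov g x) / ecov x x.

(** The gradients of the two errors up to the factor p (1 - p): the numbers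
multiplying the contributions T, T x, T f, T g and T g x of a unit. *)
Definition slr_influence : 'rV[R]_5 := \row_j
  [:: - (mean f + (1 - p) * mean g); 0; 1; 1 - p; 0]`_j.

Definition mlr_influence : 'rV[R]_5 := \row_j
  [:: - (mean f + (1 - p) * mean g - slope * mean x); - slope; 1; 1 - p; 0]`_j.

Let q_neq0 : p * (1 - p) != 0.
Proof.
by case/andP: p01 => p0 p1; rewrite mulf_neq0 ?subr_eq0 ?gt_eqF.
Qed.

Let expected_statsE :
  [/\ expected_stats 0 0 = p, expected_stats 0 1 = p * mean x,
      expected_stats 0 2 = p * mean f, expected_stats 0 3 = p * mean g &
      expected_stats 0 4 = p * mean (fun i => g i * x i)].
Proof.
have E k : expected_stats 0 k =
    p * mean (fun i => [:: 1; x i; f i; g i; g i * x i]`_k).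
  by rewrite mxE; congr (_ * mean _); apply/funext => i; rewrite mxE.
by rewrite !E /= mean_cst// mulr1.
Qed.

Local Ltac entries :=
  apply/matrixP; case=> -[|[|[|//]]] // ?; case=> -[|[|[|//]]] // ?.

(** At the expected statistics the regression coefficients are mean g for T - p
and mean f + p mean g for the constant. *)
Lemma slr_gradient :
  gradient (slr_error p f g) expected_stats = (p * (1 - p))^-1 *: slr_influence.
Proof.
have := expected_statsE; move: expected_stats => s [c0 c1 c2 c3 c4].
have uG : slr_gram p s \in unitmx.
  rewrite unitmxE unitfE det_mx22 !mxE /= c0.
  by rewrite (_ : _ - _ = p * (1 - p)) //; ring.
apply/rowP => j; rewrite [LHS]mxE.
(* D k is the increment of the k-th statistic in the direction of the j-th. *)
pose D k : R := (delta_mx 0 j : 'rV[R]_5) 0 k.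
rewrite (@derive_invmx _ _ _ _ _ _ _
  (mx_of_rows 2 2 [:: [:: (1 - 2 * p) * D 0; D 0]; [:: D 0; 0]])
  (mx_of_rows 2 1 [:: [:: D 2 + (1 - p) * D 3]; [:: D 3]])
  (mx_of_rows 2 1 [:: [:: mean g]; [:: mean f + p * mean g]]))//.
- apply: (mulfI q_neq0); rewrite (invmx_mul_row _ uG); last first.
    by apply/rowP; case=> -[|[|//]] ?; rewrite !mxE /= ?c0 /=; ring.
  rewrite [in RHS]mxE mulVKf//.
  rewrite !mxE !big_ord_recl big_ord0 !mxE /D !mxE /=.
  by case: j D => -[|[|[|[|[|//]]]]] ? /= _; ring.
- by move=> h; entries; rewrite /D !mxE /=; ring.
- by move=> h; entries; rewrite /D !mxE /=; ring.
- by entries; rewrite !mxE !big_ord_recl big_ord0 !mxE /= ?c0 ?c2 ?c3; ring.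
Qed.

(** At the expected statistics T - p is orthogonal to x and to the constant; the
other two coefficients are those of the regression of f + p g on (x, 1). *)
Lemma mlr_gradient :
  gradient (mlr_error p f g x) expected_stats =
  (p * (1 - p))^-1 *: mlr_influence.
Proof.
have := expected_statsE; move: expected_stats => s [c0 c1 c2 c3 c4].
have x2 : mean (fun i => x i ^+ 2) = ecov x x + mean x * mean x.
  by rewrite ecovE// subrK.
have xf : mean (fun i => x i * f i) = ecov f x + mean f * mean x.
  by rewrite ecovC ecovE// mulrC [mean f * _]mulrC subrK.
have gx : mean (fun i => g i * x i) = ecov g x + mean g * mean x.
  by rewrite ecovE// subrK.
have uG : mlr_gram p x s \in unitmx.
  rewrite unitmxE unitfE (expand_det_row _ 0) !big_ord_recl big_ord0.
  rewrite /cofactor !det_mx22 !mxE /= c0 c1.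
  rewrite (_ : _ + _ = p * (1 - p) * ecov x x); first exact: mulf_neq0.
  by rewrite x2; ring.
apply/rowP => j; rewrite [LHS]mxE.
(* D k is the increment of the k-th statistic in the direction of the j-th. *)
pose D k : R := (delta_mx 0 j : 'rV[R]_5) 0 k.
rewrite (@derive_invmx _ _ _ _ _ _ _
  (mx_of_rows 3 3 [:: [:: (1 - 2 * p) * D 0; D 1; D 0];
                      [:: D 1; 0; 0]; [:: D 0; 0; 0]])
  (mx_of_rows 3 1 [:: [:: D 2 + (1 - p) * D 3]; [:: D 4]; [:: D 3]])
  (mx_of_rows 3 1 [:: [:: mean g]; [:: slope];
                      [:: mean f + p * mean g - slope * mean x]]))//.
- apply: (mulfI q_neq0); rewrite (invmx_mul_row _ uG); last first.
    by apply/rowP; case=> -[|[|[|//]]] ?; rewrite !mxE /= ?c0 ?c1 /=; ring.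
  rewrite [in RHS]mxE mulVKf//.
  rewrite !mxE !big_ord_recl big_ord0 !mxE /D !mxE /=.
  by case: j D => -[|[|[|[|[|//]]]]] ? /= _; ring.
- by move=> h; entries; rewrite /D !mxE /=; ring.
- by move=> h; entries; rewrite /D !mxE /=; ring.
- entries; rewrite !mxE !big_ord_recl big_ord0 !mxE /= ?c0 ?c1 ?c2 ?c3 ?c4.
  + by ring.
  + by rewrite x2 xf gx /slope; field.
  + by ring.
Qed.

End gradients.

(** * Moments of the sample averages *)

Section sampling_moments.
Context d (Om : measurableType d) (R : realType) (P : probability Om R).

(** The treatments, their products and their linear combinations are all of this
form, so that every moment below reduces to probabilities of events. *)
Lemma expectation_indic_sum (I : finType) (c : I -> R) (A : I -> set Om) :
  (forall i, measurable (A i)) ->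
  (fun w => \sum_i c i * \1_(A i) w) \in Lfun P 1 /\
  expectation P (fun w => \sum_i c i * \1_(A i) w) =
  (\sum_i c i * fine (P (A i)))%:E.
Proof.
move=> mA.
have -> : (fun w => \sum_i c i * \1_(A i) w) =
    \sum_i ((fun w => c i * \1_(A i) w) : Om -> R).
  by apply/funext => w; rewrite fct_sumE.
have term i : (fun w => c i * \1_(A i) w) \in Lfun P 1 /\
    expectation P (fun w => c i * \1_(A i) w) = (c i * fine (P (A i)))%:E.
  have iA : \1_(A i) \in Lfun P 1 by apply/Lfun1_integrable/integrable_indic.
  have -> : (fun w => c i * \1_(A i) w) = c i \o* \1_(A i).
    by apply/funext => w /=; rewrite mulrC.
  split; first exact: Lfun_scale.
  by rewrite expectationZl// expectation_indic// EFinM fineK// fin_num_measure.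
elim/big_rec2: _ => [|i e X _ [iX EX]].
  by split; [exact: Lfun_cst | rewrite expectation_cst].
have [it Et] := term i.
by split; [exact: rpredD | rewrite expectationD// EX Et].
Qed.

Context (p : R) (N : nat) (T : 'I_N -> {RV P >-> bool}).
Context (p01 : 0 < p < 1) (iidT : iid_bernoulli p T).

Let treated i := T i @^-1` [set true].

Let TE i w : (T i w)%:R = \1_(treated i) w :> R.
Proof.
rewrite indicE /treated; case E : (T i w); first by rewrite mem_set.
by rewrite memNset//= E.
Qed.

Let mtreated i : measurable (treated i).
Proof. by rewrite -[treated i]setTI; apply: measurable_funPT. Qed.

Let Ptreated i : P (treated i) = p%:E.
Proof.
have [dT _] := iidT; have := dT i [set true].
rewrite /distribution /pushforward => ->.
rewrite bernoulli_probE; last by case/andP: p01 => *; rewrite !ltW.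
by rewrite !diracE mem_set// memNset// mule1 mule0 adde0.
Qed.

Let Ptreated2 i k : i != k -> P (treated i `&` treated k) = (p * p)%:E.
Proof.
move=> ik; have [_ indT] := iidT.
have := indT [set i; k]%SET (fun=> [set true]) (fun=> I).
rewrite big_setU1 ?inE//= big_set1 !Ptreated -EFinM => <-.
congr (P _); apply/seteqP; split => w.
  by move=> [wi wk] l /=; rewrite !inE => /orP[] /eqP ->.
by move=> H; split; apply: H; rewrite /= !inE eqxx ?orbT.
Qed.

Let expect (c : 'I_N -> R) :
  (fun w => \sum_i (T i w)%:R * c i) \in Lfun P 1 /\
  expectation P (fun w => \sum_i (T i w)%:R * c i) = (p * \sum_i c i)%:E.
Proof.
have [+ +] := expectation_indic_sum c mtreated.
rewrite (_ : (fun w => _) = (fun w => \sum_i (T i w)%:R * c i)); last first.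
  by apply/funext => w; apply: eq_bigr => i _; rewrite TE mulrC.
move=> -> ->; split=> //; congr EFin; rewrite mulr_sumr; apply: eq_bigr => i _.
by rewrite Ptreated mulrC.
Qed.

Let cov (c e : 'I_N -> R) :
  covariance P (fun w => \sum_i (T i w)%:R * c i)
    (fun w => \sum_i (T i w)%:R * e i) = (p * (1 - p) * \sum_i c i * e i)%:E.
Proof.
have [ic Ec] := expect c; have [ie Ee] := expect e.
have [] := expectation_indic_sum (fun ik : 'I_N * 'I_N => c ik.1 * e ik.2)
  (fun ik => measurableI _ _ (mtreated ik.1) (mtreated ik.2)).
rewrite (_ : (fun w => _) = (fun w => \sum_i (T i w)%:R * c i) *
    (fun w => \sum_i (T i w)%:R * e i)); last first.
  apply/funext => w; rewrite -[RHS]/(_ w * _ w) /= big_distrlr /=.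
  rewrite pair_big_dep /=; apply: eq_bigr => -[i k] _ /=.
  by rewrite indicI /= -!TE; ring.
move=> ice Ece; rewrite covarianceE// Ece Ec Ee -EFinM -EFinB; congr EFin.
(* P (T_i = T_k = 1) is p ^ 2, plus p (1 - p) on the diagonal. *)
have -> : \sum_(ik : 'I_N * 'I_N) c ik.1 * e ik.2 *
      fine (P (treated ik.1 `&` treated ik.2)) =
    \sum_i \sum_k (p * c i * (p * e k) +
      (i == k)%:R * (p * (1 - p) * (c i * e k))).
  rewrite pair_big_dep /=; apply: eq_bigr => -[i k] _ /=.
  have [<-|ik] := eqVneq i k; first by rewrite setIid Ptreated /=; ring.
  by rewrite Ptreated2 //=; ring.
under eq_bigr do rewrite big_split /=.
rewrite big_split /= !mulr_sumr -big_distrlr /= [X in X + _ - _]mulr_sumr.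
rewrite addrAC subrr add0r; apply: eq_bigr => i _.
rewrite (bigD1 i)//= eqxx mul1r big1 ?addr0// => k ki.
by rewrite eq_sym (negPf ki) mul0r.
Qed.

Context (f g x : 'I_N -> R).
Context (N0 : (0 < N)%N).

Let L i j := loading f g x i 0 j.

Let statE w j :
  sample_stats T f g x w 0 j = \sum_i (T i w)%:R * (N%:R^-1 * L i j).
Proof.
rewrite mxE /mean mulr_sumr; apply: eq_bigr => i _.
by rewrite /L mxE mulrCA.
Qed.

Lemma mean_vector_sample :
  mean_vector P (sample_stats T f g x) = expected_stats p f g x.
Proof.
apply/rowP => j; rewrite !mxE.
rewrite (_ : (fun w => _) =
    fun w => \sum_i (T i w)%:R * (N%:R^-1 * L i j)); last first.
  by apply/funext => w; rewrite statE.
by rewrite (expect _).2 /= -mulr_sumr.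
Qed.

Lemma cov_matrix_sample : cov_matrix P (sample_stats T f g x) =
  (p * (1 - p) / N%:R ^+ 2) *:
  \sum_i (loading f g x i)^T *m loading f g x i.
Proof.
apply/matrixP => j k; rewrite !mxE.
rewrite (_ : (fun w => _) =
    fun w => \sum_i (T i w)%:R * (N%:R^-1 * L i j)); last first.
  by apply/funext => w; rewrite statE.
rewrite (_ : (fun w => sample_stats T f g x w 0 k) =
    fun w => \sum_i (T i w)%:R * (N%:R^-1 * L i k)); last first.
  by apply/funext => w; rewrite statE.
rewrite cov /= summxE -[RHS]mulrA; congr (_ * _); rewrite mulr_sumr.
apply: eq_bigr => i _; rewrite [in RHS]mxE big_ord1 [in RHS]mxE.
rewrite -/(L i j) -/(L i k).
by field; rewrite pnatr_eq0 -lt0n.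
Qed.

(** By independence Cov(S) is a sum of rank one matrices, one for each unit, so
that the quadratic form is a sum of squares of linearized contributions. *)
Lemma taylor_variance_sample (h : 'rV[R]_5 -> R) :
  taylor_variance P (sample_stats T f g x) h =
  p * (1 - p) / N%:R *
  mean (fun i =>
    (gradient h (expected_stats p f g x) *m (loading f g x i)^T) 0 0 ^+ 2).
Proof.
rewrite /taylor_variance mean_vector_sample cov_matrix_sample.
move: (gradient _ _) => u.
rewrite -scalemxAr -scalemxAl mxE mulmx_sumr mulmx_suml summxE /mean.
rewrite mulrA; congr (_ * _).
  by field; rewrite pnatr_eq0 -lt0n.
apply: eq_bigr => i _.
have -> : u *m ((loading f g x i)^T *m loading f g x i) *m u^T =
    (u *m (loading f g x i)^T) *m (u *m (loading f g x i)^T)^T.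
  by rewrite trmx_mul trmxK !mulmxA.
by rewrite mxE big_ord1 [X in _ * X]mxE expr2.
Qed.

Let slr_loading i :
  slr_influence p f g *m (loading f g x i)^T = (outcome_dev p f g i)%:M.
Proof.
apply/rowP => j; rewrite (ord1 j) !mxE !big_ord_recl big_ord0 !mxE /=.
by rewrite /outcome_dev; ring.
Qed.

Let mlr_loading i : mlr_influence p f g x *m (loading f g x i)^T =
  (outcome_dev p f g i - slope p f g x * (x i - mean x))%:M.
Proof.
apply/rowP => j; rewrite (ord1 j) !mxE !big_ord_recl big_ord0 !mxE /=.
by rewrite /outcome_dev; ring.
Qed.

Lemma var_slrE : var_slr p T f g x =
  mean (fun i => outcome_dev p f g i ^+ 2) / (p * (1 - p) * N%:R).
Proof.
rewrite /var_slr taylor_variance_sample slr_gradient//.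
rewrite (_ : (fun i => _) =
    (fun i => (p * (1 - p)) ^- 2 * outcome_dev p f g i ^+ 2)); last first.
  apply/funext => i; rewrite -scalemxAl slr_loading mxE mxE.
  by rewrite eqxx mulr1n exprMn exprVn.
rewrite meanZ; field.
by case/andP: p01 => p0 p1; rewrite pnatr_eq0 -lt0n N0 subr_eq0 !gt_eqF.
Qed.

Lemma var_mlrE : ecov x x != 0 -> var_mlr p T f g x =
  mean (fun i => (outcome_dev p f g i - slope p f g x * (x i - mean x)) ^+ 2)
    / (p * (1 - p) * N%:R).
Proof.
move=> Vx; rewrite /var_mlr taylor_variance_sample mlr_gradient//.
rewrite (_ : (fun i => _) = (fun i => (p * (1 - p)) ^- 2 *
    (outcome_dev p f g i - slope p f g x * (x i - mean x)) ^+ 2)); last first.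
  apply/funext => i; rewrite -scalemxAl mlr_loading mxE mxE.
  by rewrite eqxx mulr1n exprMn exprVn.
rewrite meanZ; field.
by case/andP: p01 => p0 p1; rewrite pnatr_eq0 -lt0n N0 subr_eq0 !gt_eqF.
Qed.

End sampling_moments.

(** * Product of Bernoulli distributions *)

(** An alias, so that treatment assignments carry the discrete sigma-algebra. *)
Definition assignment (N : nat) : Type := {ffun 'I_N -> bool}.

HB.instance Definition _ N := Finite.on (assignment N).
HB.instance Definition _ N :=
  isPointed.Build (assignment N) [ffun=> false].
HB.instance Definition _ N := @isMeasurable.Build default_measure_display
  (assignment N) discrete_measurable discrete_measurable0
  discrete_measurableC discrete_measurableU.

Section bernoulli_product.
Context (R : realType) (N : nat) (p : R).
Context (p01 : 0 < p < 1).

Let bern (b : bool) : R := if b then p else 1 - p.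

Let bern_ge0 b : 0 <= bern b.
Proof. by case/andP: p01 => p0 p1; case: b; rewrite /= ?subr_ge0 ltW. Qed.

Let weight (t : assignment N) : R := \prod_i bern (t i).

Let weight_ge0 t : 0 <= weight t. Proof. exact: prodr_ge0. Qed.

Let atom k : assignment N := nth point (enum {: assignment N}) k.

(** A combination of Dirac masses, indexed by ranks in the enumeration of the
assignments because finite sums of measures are indexed by natural numbers. *)
Definition bernoulli_product : set (assignment N) -> \bar R :=
  msum (fun k => mscale (NngNum (weight_ge0 (atom k))) (dirac (atom k)))
    #|{: assignment N}|.

HB.instance Definition _ := Measure.on bernoulli_product.

Let bernoulli_productE A :
  bernoulli_product A = (\sum_t weight t * (t \in A)%:R)%:E.
Proof.
rewrite /bernoulli_product /msum -sumEFin.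
rewrite -[RHS]big_enum /= (big_nth point) -cardT big_mkord.
by apply: eq_bigr => k _; rewrite EFinM -diracE.
Qed.

(** Independence comes from the distributivity of products over sums: it factors
the total weight of a cylinder. *)
Let cylinderE (A : 'I_N -> set bool) :
  bernoulli_product [set t : assignment N | forall i, A i (t i)] =
  (\prod_i (p * (true \in A i)%:R + (1 - p) * (false \in A i)%:R))%:E.
Proof.
rewrite bernoulli_productE; congr EFin.
transitivity (\prod_i \sum_b bern b * (b \in A i)%:R); last first.
  by apply: eq_bigr => i _; rewrite big_bool.
rewrite bigA_distr_bigA; apply: eq_bigr => t _; rewrite big_split /=.
congr (_ * _).
have [tA|tA] := boolP (_ \in _).
  rewrite big1// => i _; move: tA; rewrite inE => /(_ i) ?.
  by rewrite mem_set.
apply/esym/eqP/prodf_eq0; move: tA; rewrite notin_setE.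
move=> /existsNP[i Ai]; exists i => //.
by rewrite memNset.
Qed.

Let bernoulli_product_setT : bernoulli_product setT = 1%E.
Proof.
rewrite (_ : setT = [set t : assignment N | forall i, setT (t i)]).
  rewrite (cylinderE (fun=> setT)) big1// => i _.
  by rewrite !in_setT !mulr1 addrC subrK.
by apply/seteqP; split.
Qed.

HB.instance Definition _ :=
  Measure_isProbability.Build _ _ _ bernoulli_product bernoulli_product_setT.

Let coord (i : 'I_N) (t : assignment N) : bool := t i.

Let measurable_coord i : measurable_fun [set: assignment N] (coord i).
Proof. by []. Qed.

HB.instance Definition _ i :=
  isMeasurableFun.Build _ _ _ _ (coord i) (measurable_coord i).

Lemma exists_iid_bernoulli :
  exists (d : measure_display) (Om : measurableType d) (P : probability Om R)
    (T : 'I_N -> {RV P >-> bool}), iid_bernoulli p T.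
Proof.
exists default_measure_display, (assignment N), bernoulli_product.
exists (fun i => coord i : {RV bernoulli_product >-> bool}).
have bE (A : set bool) : bernoulli_prob p A =
    (p * (true \in A)%:R + (1 - p) * (false \in A)%:R)%:E.
  rewrite bernoulli_probE; last by case/andP: p01 => *; rewrite !ltW.
  by rewrite !diracE -!EFinM -EFinD.
have joint (J : {set 'I_N}) (A : 'I_N -> set bool) :
    bernoulli_product (\bigcap_(i in [set` J]) coord i @^-1` A i) =
    (\prod_(i in J) (p * (true \in A i)%:R + (1 - p) * (false \in A i)%:R))%:E.
  rewrite (_ : \bigcap_(i in _) _ = [set t : assignment N | forall i,
      (if i \in J then A i else setT) (t i)]).
    rewrite (cylinderE (fun i => if i \in J then A i else setT)).
    rewrite [in RHS]big_mkcond; congr EFin; apply: eq_bigr => i _.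
    by case: ifP => // _; rewrite !in_setT !mulr1 addrC subrK.
  apply/seteqP; split=> t /= tA i; first by case: ifPn => // iJ; exact: tA.
  by move=> /= iJ; have := tA i; rewrite iJ.
have marginal i A : bernoulli_product (coord i @^-1` A) = bernoulli_prob p A.
  rewrite bE; have := joint [set i]%SET (fun=> A); rewrite big_set1 => <-.
  congr bernoulli_product; apply/seteqP; split => t /=.
    by move=> tA k /=; rewrite inE => /eqP ->.
  by move=> /(_ i); apply; rewrite /= inE.
split=> [i A|J A _]; first exact: marginal.
apply: (eq_trans (joint J A)); rewrite (big_morph EFin (@EFinM R) erefl).
by apply: eq_bigr => i _; rewrite -bE; exact/esym/marginal.
Qed.

End bernoulli_product.

(** * Comparison of the two variances *)

Section variance_comparison.
Context d (Om : measurableType d) (R : realType) (P : probability Om R).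
Context (N : nat) (p : R) (f g x : 'I_N -> R) (T : 'I_N -> {RV P >-> bool}).
Context (expT : randomized_experiment p T x).

Let experiment_facts : [/\ 0 < p < 1, iid_bernoulli p T, (0 < N)%N,
  0 < ecov x x & 0 < p * (1 - p) * N%:R].
Proof.
have [N2 p01 [i [j xij]] iidT] := expT; split=> //; first exact: ltnW.
  exact: ecov_gt0 xij.
by case/andP: p01 => p0 p1; rewrite !mulr_gt0 ?subr_gt0 ?ltr0n// ltnW.
Qed.

Lemma var_slr_sub_mlr : var_slr p T f g x - var_mlr p T f g x =
  (ecov f x + p * ecov g x) * (ecov f x + (2 - 3 * p) * ecov g x) /
  (ecov x x * (p * (1 - p) * N%:R)).
Proof.
have [p01 iidT N0 /lt0r_neq0 Vx /lt0r_neq0 D0] := experiment_facts.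
rewrite var_slrE// var_mlrE// -mulrBl.
rewrite (_ : (fun i => (_ - _) ^+ 2) = (fun i => outcome_dev p f g i ^+ 2 +
    (- 2 * slope p f g x * ((f i - mean f) * (x i - mean x)) +
    (- 2 * slope p f g x * (1 - p) * ((g i - mean g) * (x i - mean x)) +
    slope p f g x ^+ 2 * ((x i - mean x) * (x i - mean x)))))); last first.
  by apply/funext => i; rewrite /outcome_dev; ring.
rewrite meanD meanD meanD.
rewrite (meanZ _ (fun i => (f i - mean f) * (x i - mean x))).
rewrite (meanZ _ (fun i => (g i - mean g) * (x i - mean x))).
rewrite (meanZ _ (fun i => (x i - mean x) * (x i - mean x))).
rewrite -!/(ecov _ _) /slope; move: (p * (1 - p) * N%:R) D0 => D D0.
by field; rewrite D0 Vx.
Qed.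

(** Under either hypothesis the two factors of var_slr_sub_mlr are equal. *)
Lemma mlr_le_slr : ecov g x = 0 \/ p = 1 / 2 ->
  var_mlr p T f g x <= var_slr p T f g x.
Proof.
have [_ _ _ V0 D0] := experiment_facts.
move=> H; rewrite -subr_ge0 var_slr_sub_mlr.
have -> : (ecov f x + p * ecov g x) * (ecov f x + (2 - 3 * p) * ecov g x) =
    (ecov f x + p * ecov g x) ^+ 2.
  by case: H => ->; field.
by rewrite divr_ge0 ?sqr_ge0// ltW// mulr_gt0.
Qed.

Lemma sg_var_slr_sub_mlr : ecov g x != 0 ->
  Num.sg (var_slr p T f g x - var_mlr p T f g x) =
  Num.sg ((ecov f x / ecov g x + p) * (ecov f x / ecov g x + (2 - 3 * p))).
Proof.
have [_ _ _ V0 D0] := experiment_facts.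
move=> g0; rewrite var_slr_sub_mlr.
rewrite (_ : _ / _ = ecov g x ^+ 2 / (ecov x x * (p * (1 - p) * N%:R)) *
    ((ecov f x / ecov g x + p) * (ecov f x / ecov g x + (2 - 3 * p)))).
  rewrite sgrM gtr0_sg ?mul1r//.
  by apply: divr_gt0; [rewrite exprn_even_gt0 | exact: mulr_gt0].
move: (p * (1 - p) * N%:R) (ecov x x) D0 V0 => D V /lt0r_neq0 D0 /lt0r_neq0 V0.
by field; rewrite D0 V0 g0.
Qed.

End variance_comparison.

Section sign_changes.
Context (R : realType) (N : nat).
Context (N2 : (2 <= N)%N).

Let p : R := 1 / 4.

Let p01 : 0 < p < 1. Proof. by rewrite /p; lra. Qed.

Let first_unit (i : 'I_N) : R := (val i == 0%N)%:R.

(** With g = x the indicator of one unit and f = k g, the ratio of the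
covariances is any prescribed k. *)
Lemma proportional_experiment (k : R) :
  exists (d : measure_display) (Om : measurableType d)
    (P : probability Om R) (p : R) (f g x : 'I_N -> R)
    (T : 'I_N -> {RV P >-> bool}),
  [/\ randomized_experiment p T x, ecov g x != 0, p = 1 / 4 &
      ecov f x / ecov g x = k].
Proof.
have xij : first_unit (Ordinal (ltnW N2)) != first_unit (Ordinal N2).
  by rewrite /first_unit /= oner_neq0.
have x0 : ecov first_unit first_unit != 0 by rewrite gt_eqF// (ecov_gt0 xij).
have [d [Om [P [T iidT]]]] := exists_iid_bernoulli N p01.
exists d, Om, P, p, (fun i => k * first_unit i), first_unit, first_unit, T.
split=> //; last by rewrite ecovZl mulfK.
by split=> //; exists (Ordinal (ltnW N2)), (Ordinal N2).
Qed.

End sign_changes.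

Theorem theorem1 (R : realType) :
  [/\ (forall (d : measure_display) (Om : measurableType d)
         (P : probability Om R) (N : nat) (p : R) (f g x : 'I_N -> R)
         (T : 'I_N -> {RV P >-> bool}),
       randomized_experiment p T x ->
       ecov g x = 0 \/ p = 1 / 2 ->
       var_mlr p T f g x <= var_slr p T f g x),
      (exists sigma : R -> R -> R,
        (forall (d : measure_display) (Om : measurableType d)
           (P : probability Om R) (N : nat) (p : R) (f g x : 'I_N -> R)
           (T : 'I_N -> {RV P >-> bool}),
         randomized_experiment p T x ->
         ecov g x <> 0 -> p <> 1 / 2 ->
         Num.sg (var_slr p T f g x - var_mlr p T f g x) =
         sigma p (ecov f x / ecov g x)) /\
        (forall N : nat, (2 <= N)%N ->
         (exists (d : measure_display) (Om : measurableType d)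
            (P : probability Om R) (p : R) (f g x : 'I_N -> R)
            (T : 'I_N -> {RV P >-> bool}),
          [/\ randomized_experiment p T x, ecov g x <> 0, p <> 1 / 2 &
              var_mlr p T f g x < var_slr p T f g x]) /\
         (exists (d : measure_display) (Om : measurableType d)
            (P : probability Om R) (p : R) (f g x : 'I_N -> R)
            (T : 'I_N -> {RV P >-> bool}),
          [/\ randomized_experiment p T x, ecov g x <> 0, p <> 1 / 2 &
              var_slr p T f g x < var_mlr p T f g x]))) &
      (forall (d : measure_display) (Om : measurableType d)
         (P : probability Om R) (N : nat) (p : R) (f g x : 'I_N -> R)
         (T : 'I_N -> {RV P >-> bool}),
       randomized_experiment p T x ->
       mean (fun i => (x i - mean x) ^+ 2) = 1 ->
       var_slr p T f g x - var_mlr p T f g x =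
       ((ecov f x) ^+ 2 + 2 * (1 - p) * ecov g x * ecov f x
          + (2 * p - 3 * p ^+ 2) * (ecov g x) ^+ 2)
       / (p * (1 - p) * N%:R))].
Proof.
split.
- by move=> d Om P N p f g x T; exact: mlr_le_slr.
- exists (fun p k => Num.sg ((k + p) * (k + (2 - 3 * p)))); split.
    move=> d Om P N p f g x T expT /eqP g0 _; exact: sg_var_slr_sub_mlr.
  move=> N N2; split.
  + have [d [Om [P [p [f [g [x [T [expT g0 pE kE]]]]]]]]] :=
      proportional_experiment N2 (0 : R).
    exists d, Om, P, p, f, g, x, T; split=> //; [exact/eqP|by rewrite pE; lra|].
    rewrite -subr_gt0 -sgr_gt0 (sg_var_slr_sub_mlr _ expT)// sgr_gt0 kE pE.
    by lra.
  + have [d [Om [P [p [f [g [x [T [expT g0 pE kE]]]]]]]]] :=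
      proportional_experiment N2 (- (1 / 2) : R).
    exists d, Om, P, p, f, g, x, T; split=> //; [exact/eqP|by rewrite pE; lra|].
    rewrite -subr_lt0 -sgr_lt0 (sg_var_slr_sub_mlr _ expT)// sgr_lt0 kE pE.
    by lra.
- move=> d Om P N p f g x T expT Vx.
  have V1 : ecov x x = 1.
    by rewrite -[RHS]Vx; congr mean; apply/funext => i; rewrite expr2.
  by rewrite (var_slr_sub_mlr _ _ expT) V1 mul1r; congr (_ / _); ring.
Qed.
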